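(* A complex matrix is duodiagonalizable if and only if it is symmetrically antidiagonalizable. A traceless complex matrix is duodiagonalizable if and only if it is antisymmetrically antidiagonalizable.
   Context: A matrix of size $n$ is antidiagonal if its only nonzero entries are at positions $(i,n+1-i)$, and antidiagonalizable if it is similar to an antidiagonal matrix. A matrix is duodiagonalizable if it is both diagonalizable and antidiagonalizable. A matrix is symmetrically (respectively antisymmetrically) antidiagonalizable if it is similar to an antidiagonal matrix $A$ with $A^\top=A$ (respectively $A^\top=-A$). *)

(* Defs.v *)
From HB Require Import structures.
From mathcomp Require Import all_boot all_order all_algebra.
From mathcomp Require Import reals complex.

Set Implicit Arguments.
Unset Strict Implicit.
Unset Printing Implicit Defensive.

Import GRing.Theory.
Local Open Scope ring_scope.

(* [rev_ord] sends the 0-based index i to n - 1 - i, that is, the 1-based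
   index i to n + 1 - i. *)
Definition is_antidiag_mx (V : nmodType) (n : nat) (A : 'M[V]_n) : bool :=
  [forall i, forall j, (j != rev_ord i) ==> (A i j == 0)].

Lemma is_antidiag_mxP (V : nmodType) (n : nat) (A : 'M[V]_n) :
  reflect (forall i j, j != rev_ord i -> A i j = 0) (is_antidiag_mx A).
Proof.
apply: (iffP 'forall_forallP) => [H i j ne|H i j].
  by apply/eqP; apply: (implyP (H i j)).
by apply/implyP => /H ->.
Qed.

Section Antidiagonalizable.
Variables (F : fieldType) (n : nat).
Implicit Type A : 'M[F]_n.

Definition antidiagonalizable A : Prop :=
  exists2 B : 'M[F]_n, is_antidiag_mx B & A ~_{in unitmx} B.

Definition duodiagonalizable A : Prop :=
  diagonalizable A /\ antidiagonalizable A.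

Definition sym_antidiagonalizable A : Prop :=
  exists B : 'M[F]_n, [/\ is_antidiag_mx B, B^T = B & A ~_{in unitmx} B].

Definition antisym_antidiagonalizable A : Prop :=
  exists B : 'M[F]_n, [/\ is_antidiag_mx B, B^T = - B & A ~_{in unitmx} B].

End Antidiagonalizable.

(* Main.v *)
(* If B is antidiagonal and diagonalizable, then u B^2 = 0 forces u B = 0, so
   the entries b_i = B_(i, i') and b_i' (with i' = n + 1 - i) vanish
   simultaneously. Conjugating B by an invertible diagonal matrix D replaces
   b_i by d_i b_i / d_i', and taking d_i to be a square root of b_i', up to a
   sign on one half of the indices, makes the result symmetric or
   antisymmetric; in the antisymmetric case the middle entry vanishes because
   it is the trace. Conversely, a complex antidiagonal matrix that is symmetric
   or antisymmetric is normal, hence diagonalizable by the spectral theorem. *)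
Require Import Defs.
From mathcomp Require Import all_boot all_order all_algebra.
From mathcomp Require Import reals complex.
From mathcomp Require Import zify ring.

Set Implicit Arguments.
Unset Strict Implicit.
Unset Printing Implicit Defensive.

Import Order.TTheory GRing.Theory Num.Theory.

Local Open Scope ring_scope.

Section Similarity.
Variables (F : fieldType) (n : nat).
Implicit Types A B C : 'M[F]_n.

Lemma simmx_inP A B :
  A ~_{in unitmx} B <-> exists2 P, P \in unitmx & P *m A = B *m P.
Proof. by split=> -[P Pu] /(simmxP Pu); exists P. Qed.

Lemma simmx_in_sym A B : A ~_{in unitmx} B -> B ~_{in unitmx} A.
Proof.
move=> /simmx_inP[P Pu PA]; apply/simmx_inP; exists (invmx P).
  by rewrite unitmx_inv.
by rewrite -{1}(mulmxK Pu B) -PA !mulmxA mulVmx // mul1mx.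
Qed.

Lemma simmx_in_trans A B C :
  A ~_{in unitmx} B -> B ~_{in unitmx} C -> A ~_{in unitmx} C.
Proof.
move=> /simmx_inP[P Pu PA] /simmx_inP[Q Qu QB]; apply/simmx_inP.
by exists (Q *m P); rewrite ?unitmx_mul ?Qu // -mulmxA PA !mulmxA QB.
Qed.

Lemma simmx_in_mxtrace A B : A ~_{in unitmx} B -> \tr A = \tr B.
Proof.
move=> /simmx_inP[P Pu PA].
by rewrite -(mulmxK Pu B) -PA mxtrace_mulC mulmxA mulVmx // mul1mx.
Qed.

Lemma diagonalizable_simmx A :
  diagonalizable A <-> exists d : 'rV[F]_n, A ~_{in unitmx} diag_mx d.
Proof.
split=> [[P Pu /similar_diagPex[d Ad]]|[d [P Pu Ad]]]; first by exists d, P.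
by exists P => //; apply/similar_diagPex; exists d.
Qed.

Lemma simmx_in_diagonalizable A B :
  A ~_{in unitmx} B -> diagonalizable B -> diagonalizable A.
Proof.
move=> AB /diagonalizable_simmx[d Bd].
by apply/diagonalizable_simmx; exists d; apply: simmx_in_trans Bd.
Qed.

(** In eigenvector coordinates w = u P the hypothesis reads w_j d_j^2 = 0 for each j, which forces
    w_j d_j = 0 in a field. *)
Lemma diagonalizable_mulmx_sqr_eq0 B (u : 'rV[F]_n) :
  diagonalizable B -> u *m B *m B = 0 -> u *m B = 0.
Proof.
move=> /diagonalizable_simmx[d /simmx_in_sym /simmx_inP[P Pu PB]] uBB0.
suff: u *m B *m P = 0.
  by move/(congr1 (mulmxr (invmx P))); rewrite /= mulmxK // mul0mx.
have: u *m P *m diag_mx d *m diag_mx d = 0.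
  by rewrite -(mulmxA u P) PB mulmxA -(mulmxA _ P) PB mulmxA uBB0 mul0mx.
rewrite -(mulmxA u B) -PB mulmxA => wd0; apply/rowP=> j.
move/rowP/(_ j)/eqP: wd0; rewrite !mul_mx_diag !mxE mulf_eq0.
by rewrite mulf_eq0 -orbA orbb => /orP[]/eqP->; rewrite ?mul0r ?mulr0.
Qed.

End Similarity.

Section Antidiagonal.
Variables (F : fieldType) (n : nat).
Implicit Type B : 'M[F]_n.

Lemma delta_mulmx_antidiag B i : is_antidiag_mx B ->
  (delta_mx 0 i : 'rV_n) *m B = B i (rev_ord i) *: (delta_mx 0 (rev_ord i) : 'rV_n).
Proof.
move=> /is_antidiag_mxP B0; rewrite -rowE; apply/rowP=> j; rewrite !mxE eqxx /=.
by have [->|/B0->] := eqVneq j (rev_ord i); rewrite ?mulr1 ?mulr0.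
Qed.

(** With i' = [rev_ord i], B sends the row vector e_i' to a multiple of e_i, and e_i to 0, so e_i'
    B^2 = 0 and hence e_i' B = 0. *)
Lemma diagonalizable_antidiag_eq0 B i : is_antidiag_mx B -> diagonalizable B ->
  B i (rev_ord i) = 0 -> B (rev_ord i) i = 0.
Proof.
move=> aB dB Bi0; have := @delta_mulmx_antidiag B (rev_ord i) aB.
rewrite rev_ordK => eB.
have: (delta_mx 0 (rev_ord i) : 'rV_n) *m B = 0.
  apply: (diagonalizable_mulmx_sqr_eq0 dB).
  by rewrite eB -scalemxAl delta_mulmx_antidiag // Bi0 scale0r scaler0.
by rewrite eB => /rowP/(_ i); rewrite !mxE !eqxx mulr1.
Qed.

(** [rev_ord] has at most one fixed point, so every other diagonal entry lies off the
    antidiagonal. *)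
Lemma mxtrace_antidiag B i :
  is_antidiag_mx B -> i = rev_ord i -> \tr B = B i i.
Proof.
move=> /is_antidiag_mxP B0 ii; rewrite /mxtrace (bigD1 i) //= big1 ?addr0 // => j.
move=> ji; apply: B0; apply: contraNneq ji => jj; apply/eqP/val_inj.
by move: (congr1 val ii) (congr1 val jj) (ltn_ord i) (ltn_ord j) => /=; lia.
Qed.

End Antidiagonal.

Section NumClosed.
Variables (C : numClosedFieldType) (n : nat).
Implicit Type B : 'M[C]_n.

Lemma normal_diagonalizable B : B \is normalmx -> diagonalizable B.
Proof.
move=> /orthomx_spectralP eB; apply/diagonalizable_simmx.
exists (spectral_diag B); apply/simmx_inP; exists (spectralmx B).
  exact: spectral_unit.
by rewrite {2}eB !mulmxA mulmxV ?spectral_unit // mul1mx.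
Qed.

(** The sign s = (-1)^e covers both symmetry types. Normality reduces to B commuting with its
    entrywise conjugate: both products are diagonal, with entries s |b_i|^2. *)
Lemma antidiag_signsym_diagonalizable (e : bool) B :
  is_antidiag_mx B -> B^T = (-1) ^+ e *: B -> diagonalizable B.
Proof.
move=> aB sB; apply/normal_diagonalizable/normalmxP.
have eB i j : B j i = (-1) ^+ e * B i j by have /matrixP/(_ i j) := sB; rewrite !mxE.
rewrite sB map_mxZ /= rmorph_sign -scalemxAl -scalemxAr; congr (_ *: _).
move/is_antidiag_mxP: aB => B0.
apply/matrixP=> i k; rewrite !mxE; apply: eq_bigr => j _; rewrite !mxE.
have [->|ji] := eqVneq j (rev_ord i); last by rewrite B0 // conjC0 !mul0r.
have [->|ki] := eqVneq k i; first by rewrite (eB i) rmorphM rmorph_sign; ring.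
by rewrite (B0 (rev_ord i)) ?rev_ordK // conjC0 !mulr0.
Qed.

(** A diagonal conjugation leaves the middle entry unchanged, so that entry must satisfy the
    symmetry from the start. *)
Lemma antidiag_signsymmetrization (e : bool) B :
  is_antidiag_mx B -> diagonalizable B ->
  (forall i, i = rev_ord i -> B i i = (-1) ^+ e * B i i) ->
  exists S : 'M[C]_n,
    [/\ is_antidiag_mx S, S^T = (-1) ^+ e *: S & B ~_{in unitmx} S].
Proof.
move=> aB dB mid; set s := (-1) ^+ e.
(* The factor s sits on the second half of the indices only. Where the entry under the root
   vanishes, [d] takes the value 1, which keeps the conjugating matrix invertible. *)
pose eps (i : 'I_n) : C := if (i <= rev_ord i)%N then 1 else s.
pose d i : C := if B (rev_ord i) i == 0 then 1 else sqrtC (eps i * B (rev_ord i) i).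
have s_neq0 : s != 0 by rewrite signr_eq0.
have eps_neq0 i : eps i != 0 by rewrite /eps; case: ifP; rewrite ?oner_eq0.
have d_neq0 i : d i != 0.
  rewrite /d; have [_|b0] := eqVneq (B (rev_ord i) i) 0.
    exact: oner_neq0.
  by rewrite sqrtC_eq0 mulf_neq0.
have d_sqr i : B (rev_ord i) i != 0 -> d i ^+ 2 = eps i * B (rev_ord i) i.
  by rewrite /d => /negPf->; rewrite sqrtCK.
have eps_rev i : i != rev_ord i -> eps (rev_ord i) = s * eps i.
  rewrite -(inj_eq val_inj) /= => ii; rewrite /eps rev_ordK.
  by case: ltngtP ii => // _ _; rewrite ?mulr1 -?expr2 ?sqrr_sign.
(* This is the required symmetry d_i' b_i' / d_i = s d_i b_i / d_i' without denominators. If b_i and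
   b_i' are nonzero and i is not the middle index, both sides equal s eps_i b_i b_i'. *)
have key i : d (rev_ord i) ^+ 2 * B (rev_ord i) i = s * (d i ^+ 2 * B i (rev_ord i)).
  have [b0|b0] := eqVneq (B (rev_ord i) i) 0.
    have := @diagonalizable_antidiag_eq0 _ _ B (rev_ord i) aB dB.
    by rewrite rev_ordK b0 => ->; rewrite ?mulr0.
  have b'0 : B i (rev_ord i) != 0.
    by apply: contra_neq b0; apply: diagonalizable_antidiag_eq0.
  have [ii|ii] := eqVneq i (rev_ord i).
    by rewrite -ii mulrCA -mid.
  by rewrite d_sqr ?d_sqr ?rev_ordK // eps_rev //; ring.
have /is_antidiag_mxP B0 := aB.
exists (\matrix_(i, j) (d i * B i j / d j)); split.
- by apply/is_antidiag_mxP => i j ji; rewrite mxE B0 // mulr0 mul0r.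
- apply/matrixP=> i j; rewrite !mxE.
  have [->|ji] := eqVneq j (rev_ord i); last first.
    rewrite !B0 ?mulr0 ?mul0r ?mulr0 //.
    by apply: contra_neq ji => ->; rewrite rev_ordK.
  apply: (mulIf (mulf_neq0 (d_neq0 i) (d_neq0 (rev_ord i)))).
  transitivity (d (rev_ord i) ^+ 2 * B (rev_ord i) i).
    by field; rewrite d_neq0.
  by rewrite key; field; rewrite d_neq0.
- apply/simmx_inP; exists (diag_mx (\row_i d i)).
    rewrite unitmxE det_diag unitfE; apply/prodf_neq0 => i _.
    by rewrite mxE.
  rewrite mul_diag_mx mul_mx_diag; apply/matrixP => i j; rewrite !mxE.
  by rewrite mulfVK.
Qed.

(** The trace condition is guarded by [e], so [e = false] gives the symmetric case for all
    matrices. *)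
Lemma duodiagonalizable_signsym (e : bool) (A : 'M[C]_n) :
  (e -> \tr A = 0) ->
  duodiagonalizable A <->
  exists B : 'M[C]_n,
    [/\ is_antidiag_mx B, B^T = (-1) ^+ e *: B & A ~_{in unitmx} B].
Proof.
move=> trA; split=> [[dA [B aB AB]]|[B [aB sB AB]]]; last first.
  split; last by exists B.
  exact: simmx_in_diagonalizable AB (antidiag_signsym_diagonalizable aB sB).
have dB := simmx_in_diagonalizable (simmx_in_sym AB) dA.
have [i ii|S [aS sS BS]] := antidiag_signsymmetrization (e := e) aB dB.
  (* For [e = true] the middle entry equals tr B = tr A = 0. *)
  case: e trA => [/(_ isT) trA|_]; last by rewrite mul1r.
  by rewrite -(mxtrace_antidiag aB ii) -(simmx_in_mxtrace AB) trA mulr0.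
by exists S; split=> //; apply: simmx_in_trans BS.
Qed.

End NumClosed.

Theorem corollary5p19 (R : realType) (n : nat) :
  (forall A : 'M[R[i]]_n, duodiagonalizable A <-> sym_antidiagonalizable A) /\
  (forall A : 'M[R[i]]_n, \tr A = 0 ->
     (duodiagonalizable A <-> antisym_antidiagonalizable A)).
Proof.
split=> A => [|trA].
  have := @duodiagonalizable_signsym _ n false A.
  rewrite /sym_antidiagonalizable => ->; last by [].
  by split=> -[B [aB sB AB]]; exists B; move: sB; rewrite scale1r.
rewrite /antisym_antidiagonalizable.
have -> := @duodiagonalizable_signsym _ n true A (fun=> trA).
by split=> -[B [aB sB AB]]; exists B; move: sB; rewrite scaleN1r.
Qed.
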